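(* An oracle that solves the generalized modHomSP for $(S_B,S_A)$ and the $O_A$-MSP for $S_A$ is sufficient to break key establishment Protocol 2.
   Context: Let $L$ be a set with non-empty families $O_A,O_B$ of binary operations such that $x*_\alpha(y*_\beta z)=(x*_\alpha y)*_\beta(x*_\alpha z)$ and $x*_\beta(y*_\alpha z)=(x*_\beta y)*_\alpha(x*_\beta z)$ for all $x,y,z\in L$, $*_\alpha\in O_A$, $*_\beta\in O_B$. For a family $O$ of operations, $T_O(y_1,\ldots,y_k)$ denotes the evaluation of a planar rooted binary tree with leaves labelled $y_1,\ldots,y_k$ and each internal vertex labelled by an operation in $O$ (this labelling is part of the data), and $\langle y_1,\ldots,y_k\rangle_O$ is the set of all such evaluations with leaves in $\{y_1,\ldots,y_k\}$. For $x=(x_1,\ldots,x_k)\in L^k$ and a vector of operations $o=( *_1,\ldots,*_k)$ put $\phi_{(x,o)}(y)=x_k*_k(x_{k-1}*_{k-1}\cdots(x_2*_2(x_1*_1y))\cdots)$. Protocol 2: public elements $s_1,\ldots,s_m,t_1,\ldots,t_n\in L$ are given, $S_A=\langle s_1,\ldots,s_m\rangle_{O_A}$, $S_B=\langle t_1,\ldots,t_n\rangle_{O_B}$. Alice's secret key is $(a_0,a,o_A)\in S_A\times L^{k_A}\times O_A^{k_A}$, Bob's is $(b,o_B)\in S_B^{k_B}\times O_B^{k_B}$ (with secret $k_A,k_B\ge1$). Put $\alpha=\phi_{(a,o_A)}$, $\beta=\phi_{(b,o_B)}$. Alice publishes $t_i'=\alpha(t_i)$ ($i\le n$) and $p_0=\alpha(a_0)$;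 Bob publishes $s_j'=\beta(s_j)$ ($j\le m$). The shared key is $K=\alpha(\beta(a_0))$. Breaking the protocol means finding $K$ from the public data $s_j,s_j',t_i,t_i',p_0$ (the attacker can evaluate the operations in $O_A\cup O_B$). Generalized modHomSP (modified Homomorphism Search Problem) for $(S_B,S_A)$: given pairs $(t_1,t_1'),\ldots,(t_n,t_n')\in L^2$ and $p_0\in L$ for which there are unknown $k_A$, $a\in L^{k_A}$, $o_A\in O_A^{k_A}$ and $a_0\in S_A$ with $t_i'=\phi_{(a,o_A)}(t_i)$ for all $i\le n$ and $p_0=\phi_{(a,o_A)}(a_0)$, find $k_A'\in\mathbb{N}$, $a_0'\in S_A$, $a'\in L^{k_A'}$ and $o_A'\in O_A^{k_A'}$, defining a magma homomorphism $\phi_{(a',o_A')}:S_B\to(L,O_B)$, such that $\phi_{(a',o_A')}(t_i)=t_i'$ for all $i\le n$ and $\phi_{(a',o_A')}(a_0')=p_0$. $O_A$-MSP ($O_A$-submagma Membership Search Problem) for $S_A$: given $s_1,\ldots,s_m$ and $c\in S_A$, find an expression $c=T_{O_A}(r_1,\ldots,r_l)$ with $r_1,\ldots,r_l\in\{s_1,\ldots,s_m\}$. *)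

(* Defs.v *)
From mathcomp Require Import all_boot.
From mathcomp Require Import boolp.
Set Implicit Arguments.
Unset Strict Implicit.
Unset Printing Implicit Defensive.

(* A family O of binary operations on L is given by a type O of names and
   op : O -> L -> L -> L. *)
Definition distributes_over (L O1 O2 : Type)
    (op1 : O1 -> L -> L -> L) (op2 : O2 -> L -> L -> L) : Prop :=
  forall (i : O1) (j : O2) (x y z : L),
    op1 i x (op2 j y z) = op2 j (op1 i x y) (op1 i x z).

Definition mutually_distributive (L OA OB : Type)
    (opA : OA -> L -> L -> L) (opB : OB -> L -> L -> L) : Prop :=
  distributes_over opA opB /\ distributes_over opB opA.

Inductive tree (O Y : Type) : Type :=
| Leaf of Y
| Node of O & tree O Y & tree O Y.

Fixpoint tree_eval (L O : Type) (op : O -> L -> L -> L) (T : tree O L) : L :=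
  match T with
  | Leaf y => y
  | Node o l r => op o (tree_eval op l) (tree_eval op r)
  end.

Fixpoint leaves_in (O Y : Type) (P : Y -> Prop) (T : tree O Y) : Prop :=
  match T with
  | Leaf y => P y
  | Node _ l r => leaves_in P l /\ leaves_in P r
  end.

Fixpoint tree_size (O Y : Type) (T : tree O Y) : nat :=
  match T with
  | Leaf _ => 1
  | Node _ l r => (tree_size l + tree_size r).+1
  end.

Definition expresses (L O : Type) (op : O -> L -> L -> L)
    (m : nat) (s : m.-tuple L) (T : tree O L) (c : L) : Prop :=
  leaves_in (fun r => exists i : 'I_m, r = tnth s i) T /\ tree_eval op T = c.

Definition generated (L O : Type) (op : O -> L -> L -> L)
    (m : nat) (s : m.-tuple L) (c : L) : Prop :=
  exists T : tree O L, expresses op s T c.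

(* x_1 is applied first: phi y = x_k *_k (... (x_2 *_2 (x_1 *_1 y))). *)
Definition phi (L O : Type) (op : O -> L -> L -> L)
    (k : nat) (x : k.-tuple L) (o : k.-tuple O) (y : L) : L :=
  foldl (fun z p => op p.2 p.1 z) y (zip x o).

Record homReply (L OA : Type) : Type := HomReply {
  hr_k : nat;
  hr_a0 : L;
  hr_a : hr_k.-tuple L;
  hr_o : hr_k.-tuple OA }.

Section Problems.
Variables (L OA OB : Type).
Variables (opA : OA -> L -> L -> L) (opB : OB -> L -> L -> L).
Variables (m n : nat) (s : m.-tuple L) (t : n.-tuple L).

Definition modHomSP_instance (t' : n.-tuple L) (p0 : L) : Prop :=
  exists (k : nat) (a : k.-tuple L) (o : k.-tuple OA) (a0 : L),
    [/\ 0 < k, generated opA s a0,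
        (forall i, tnth t' i = phi opA a o (tnth t i))
      & p0 = phi opA a o a0].

Definition modHomSP_solution (t' : n.-tuple L) (p0 : L)
    (r : homReply L OA) : Prop :=
  let f := phi opA (hr_a r) (hr_o r) in
  [/\ generated opA s (hr_a0 r),
      (forall (j : OB) (x y : L), generated opB t x -> generated opB t y ->
         f (opB j x y) = opB j (f x) (f y)),
      (forall i, f (tnth t i) = tnth t' i)
    & f (hr_a0 r) = p0].

(* The replies to queries violating the promise are unconstrained. *)
Definition solves_modHomSP (hom : n.-tuple L -> L -> homReply L OA) : Prop :=
  forall t' p0, modHomSP_instance t' p0 -> modHomSP_solution t' p0 (hom t' p0).

Definition solves_MSP (msp : L -> tree OA L) : Prop :=
  forall c, generated opA s c -> expresses opA s (msp c) c.

End Problems.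

(* Black-box oracle programs: the attacker does not see the tables of the
   operations. Access to L is by evaluating operations, testing equality, and
   querying the two oracles, each such access being one step. *)
Inductive prog (L OA OB : Type) (n : nat) : Type :=
| Return of L
| EvalA of OA & L & L & (L -> prog L OA OB n)
| EvalB of OB & L & L & (L -> prog L OA OB n)
| TestEq of L & L & (bool -> prog L OA OB n)
| AskHom of n.-tuple L & L & (homReply L OA -> prog L OA OB n)
| AskMSP of L & (tree OA L -> prog L OA OB n).

(* [trace] has one entry per step: for an oracle query the (positive) size of
   the reply, counted in elements of L and names of operations; 0 otherwise. *)
Record outcome (L : Type) : Type := Outcome {
  result : L;
  trace : seq nat }.

Definition step (L : Type) (size : nat) (r : outcome L) : outcome L :=
  Outcome (result r) (size :: trace r).

Fixpoint exec (L OA OB : Type)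
    (opA : OA -> L -> L -> L) (opB : OB -> L -> L -> L) (n : nat)
    (hom : n.-tuple L -> L -> homReply L OA) (msp : L -> tree OA L)
    (p : prog L OA OB n) : outcome L :=
  match p with
  | Return x => Outcome x [::]
  | EvalA o x y k => step 0 (exec opA opB hom msp (k (opA o x y)))
  | EvalB o x y k => step 0 (exec opA opB hom msp (k (opB o x y)))
  | TestEq x y k => step 0 (exec opA opB hom msp (k `[< x = y >]))
  | AskHom t' p0 k =>
      let r := hom t' p0 in
      step (hr_k r).*2.+1 (exec opA opB hom msp (k r))
  | AskMSP c k =>
      let T := msp c in
      step (tree_size T) (exec opA opB hom msp (k T))
  end.

(* Boundedly many oracle queries, and at every moment the number of steps taken
   is polynomial in the size of the data received so far: the public data
   and the replies already obtained. Charging against earlier replies only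
   prevents an attacker from buying time with later queries. *)
Definition efficient (c d input_size : nat) (tr : seq nat) : Prop :=
  count (fun z => 0 < z) tr <= c /\
  forall i, i < size tr -> i < c * (input_size + sumn (take i tr)) ^ d.

Record public_data (L : Type) (m n : nat) : Type := PublicData {
  pub_s : m.-tuple L;
  pub_s' : m.-tuple L;
  pub_t : n.-tuple L;
  pub_t' : n.-tuple L;
  pub_p0 : L }.

(* A single adversary, uniform in the platform L and in the sizes m, n. *)
Definition adversary : Type :=
  forall (L OA OB : Type) (m n : nat), public_data L m n -> prog L OA OB n.

(* Main.v *)
(** The attacker asks for a pair (a0', alpha') as in the modHomSP and for a tree
    T over the s_j with value a0'.  As beta is a homomorphism for O_A, evaluating
    T on the published beta(s_j) gives beta(a0'), and the attacker returns
    alpha'(beta(a0')).  Both alpha and alpha' are homomorphisms for O_B which agree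
    on the t_i, hence on the coefficients b_i of beta, so
    alpha' o beta = phi_(alpha(b), o_B) o alpha' and likewise for alpha.  Since
    alpha'(a0') = p0 = alpha(a0), both sides give phi_(alpha(b), o_B)(p0). *)
Require Import Defs.
From mathcomp Require Import all_boot.
From mathcomp Require Import boolp zify.
Set Implicit Arguments.
Unset Strict Implicit.
Unset Printing Implicit Defensive.

Definition op_morphism (L O : Type) (op : O -> L -> L -> L) (f : L -> L) : Prop :=
  forall j x y, f (op j x y) = op j (f x) (f y).

(** Distributivity says that each left multiplication is an endomorphism, and [phi] composes left
    multiplications. *)
Lemma phi_morphism (L O1 O2 : Type)
    (op1 : O1 -> L -> L -> L) (op2 : O2 -> L -> L -> L)
    (k : nat) (x : k.-tuple L) (o : k.-tuple O1) :
  distributes_over op1 op2 -> op_morphism op2 (phi op1 x o).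
Proof.
move=> dist j; rewrite /phi; elim: (zip x o) => [|p l IHl] y z //=.
by rewrite dist IHl.
Qed.

Lemma morphism_phi (L O : Type) (op : O -> L -> L -> L) (f : L -> L)
    (k : nat) (b : k.-tuple L) (o : k.-tuple O) (y : L) :
  op_morphism op f -> f (phi op b o y) = phi op (map_tuple f b) o (f y).
Proof.
move=> fM; rewrite /phi /=.
elim: (tval b) (tval o) y => [|x l IHl] [|q r] y //=.
by rewrite IHl fM.
Qed.

Lemma eq_morphism_generated (L O : Type) (op : O -> L -> L -> L) (f g : L -> L)
    (n : nat) (t : n.-tuple L) (c : L) :
  op_morphism op f -> op_morphism op g ->
  (forall i, f (tnth t i) = g (tnth t i)) ->
  generated op t c -> f c = g c.
Proof.
move=> fM gM eq_fg [T [+ <-]].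
elim: T => [y [i ->] | o l IHl r IHr [/IHl eql /IHr eqr]] /=; first exact: eq_fg.
by rewrite fM gM eql eqr.
Qed.

(** Keeps the input size positive; with input size 0 the bound in [efficient] would already fail at
    the first step. *)
Lemma generated_size_gt0 (L O : Type) (op : O -> L -> L -> L)
    (m : nat) (s : m.-tuple L) (c : L) :
  generated op s c -> 0 < m.
Proof.
case=> T [+ _]; elim: T => [y [i _] | o l IHl r _ [/IHl]] //.
exact: leq_ltn_trans (ltn_ord i).
Qed.

Section Programs.
Variables (L OA OB : Type) (n : nat).
Implicit Type k : L -> prog L OA OB n.

(** The leaves of the tree in a reply are elements of [L], not indices, so the position of a leaf
    among the s_j is recovered by equality tests. The default [k r] is not reached when [r] is one
    of the s_j. *)
Fixpoint lookup_prog (ps : seq (L * L)) (r : L) k : prog L OA OB n :=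
  if ps is (x, y) :: ps' then
    TestEq r x (fun e => if e then k y else lookup_prog ps' r k)
  else k r.

Fixpoint subst_prog (ps : seq (L * L)) (T : tree OA L) k : prog L OA OB n :=
  match T with
  | Leaf r => lookup_prog ps r k
  | Node o l r =>
      subst_prog ps l (fun x => subst_prog ps r (fun y => EvalA o x y k))
  end.

Fixpoint phi_prog (ps : seq (L * OA)) (y : L) k : prog L OA OB n :=
  if ps is p :: ps' then EvalA p.2 p.1 y (fun z => phi_prog ps' z k) else k y.

Definition attack_prog (m : nat) (pub : public_data L m n) : prog L OA OB n :=
  AskHom (pub_t' pub) (pub_p0 pub) (fun h =>
    AskMSP (hr_a0 h) (fun T =>
      subst_prog (zip (pub_s pub) (pub_s' pub)) T (fun y =>
        phi_prog (zip (hr_a h) (hr_o h)) y (@Return L OA OB n)))).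

Variables (opA : OA -> L -> L -> L) (opB : OB -> L -> L -> L).
Variables (hom : n.-tuple L -> L -> homReply L OA) (msp : L -> tree OA L).
Notation run := (exec opA opB hom msp).

(** Repeated entries of [s] do no harm: whichever copy of [r] matches first, its partner is
    [f r]. *)
Lemma exec_lookup (f : L -> L) (s : seq L) (r : L) k :
  has (fun x => `[< r = x >]) s ->
  exists2 j, j <= size s &
    run (lookup_prog (zip s (map f s)) r k) = iter j (step 0) (run (k (f r))).
Proof.
elim: s => //= x s IHs; case: asboolP => [<- _ | _ /= /IHs[j le_j ->]].
  by exists 1.
by exists j.+1.
Qed.

(** Each leaf costs at most [m] tests and each inner node one evaluation, where the morphism
    property moves [f] up to the root. *)
Lemma exec_subst (f : L -> L) (m : nat) (s : m.-tuple L) (T : tree OA L) k :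
  op_morphism opA f ->
  leaves_in (fun r => exists i : 'I_m, r = tnth s i) T ->
  exists2 j, j <= m.+1 * tree_size T &
    run (subst_prog (zip s (map f s)) T k)
      = iter j (step 0) (run (k (f (tree_eval opA T)))).
Proof.
move=> fM; elim: T k => [r | o l IHl r IHr] k /=.
  case=> i def_r; have [|j le_j ->] := @exec_lookup f s r k.
    by apply/has_tnthP; exists i; apply/asboolP.
  by exists j => //; rewrite muln1 (leq_trans le_j) // size_tuple.
case=> /IHl{}IHl /IHr{}IHr.
have [i le_i ->] := IHl (fun x =>
  subst_prog (zip s (map f s)) r (fun y => EvalA o x y k)).
have [j le_j ->] := IHr (EvalA o (f (tree_eval opA l)) ^~ k).
exists (i + j.+1); first by nia.
by rewrite iterD iterSr /= fM.
Qed.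

Lemma exec_phi (l : nat) (x : l.-tuple L) (o : l.-tuple OA) (y : L) k :
  run (phi_prog (zip x o) y k) = iter l (step 0) (run (k (phi opA x o y))).
Proof.
have size_xo: size (zip x o) = l by rewrite size_zip !size_tuple minnn.
rewrite /phi -[X in iter X]size_xo.
by elim: (zip x o) y => //= p ps IHps y; rewrite IHps.
Qed.

End Programs.

Lemma iter_step0 (L : Type) (j : nat) (x : L) :
  iter j (step 0) (Outcome x [::]) = Outcome x (nseq j 0).
Proof. by elim: j => //= j ->. Qed.

(** Here [h] and [M] are the sizes of the two replies. The two queries are paid for by [N] and
    [N + h], and all later steps by [N + h + M]. *)
Lemma efficient_two_queries (N h M j : nat) :
  0 < N -> 0 < h -> 0 < M -> j.+2 <= 2 * (N + (h + M)) ^ 2 ->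
  efficient 2 2 N [:: h, M & nseq j 0].
Proof.
move=> N_gt0 h_gt0 M_gt0 le_j; split.
  by rewrite /= h_gt0 M_gt0 count_nseq.
case=> [|[|i]] /=; rewrite ?take0 /= ?addn0 ?size_nseq => lt_i; nia.
Qed.

Theorem proposition4p3 :
  exists (attack : adversary) (c d : nat),
  forall (L OA OB : Type)
    (opA : OA -> L -> L -> L) (opB : OB -> L -> L -> L)
    (hOA : inhabited OA) (hOB : inhabited OB)
    (hdist : mutually_distributive opA opB)
    (m n : nat) (s : m.-tuple L) (t : n.-tuple L)
    (hom : n.-tuple L -> L -> homReply L OA) (msp : L -> tree OA L)
    (hhom : solves_modHomSP opA opB s t hom)
    (hmsp : solves_MSP opA s msp)
    (kA kB : nat) (hkA : 0 < kA) (hkB : 0 < kB)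
    (a0 : L) (a : kA.-tuple L) (oA : kA.-tuple OA)
    (b : kB.-tuple L) (oB : kB.-tuple OB)
    (ha0 : generated opA s a0)
    (hb : forall i : 'I_kB, generated opB t (tnth b i)),
  let alpha := phi opA a oA in
  let beta := phi opB b oB in
  let pub := PublicData s (map_tuple beta s) t (map_tuple alpha t) (alpha a0) in
  let run := exec opA opB hom msp (attack L OA OB m n pub) in
  result run = alpha (beta a0) /\
  efficient c d (m + n) (trace run).
Proof.
(* There are two queries; the degree 2 comes from the substitution cost, a product of [m.+1] and the
   size of the tree. *)
exists (fun L OA OB m n => @attack_prog L OA OB n m), 2, 2 => L OA OB opA opB _ _ [distAB distBA] m n s t hom msp.
move=> hhom hmsp kA kB kA_gt0 _ a0 a oA b oB ha0 hb alpha beta pub run.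
have m_gt0 := generated_size_gt0 ha0.
have /hhom: modHomSP_instance opA s t (map_tuple alpha t) (alpha a0).
  by exists kA, a, oA, a0; split=> // i; rewrite tnth_map.
rewrite {}/run /=; case: (hom _ _) => k a0' a' o' [/= ha0' _ eq_t eq_p0].
have [leavesT evalT] := hmsp _ ha0'.
have alphaM : op_morphism opB alpha by apply: phi_morphism.
have alpha'M : op_morphism opB (phi opA a' o') by apply: phi_morphism.
have betaM : op_morphism opA beta by apply: phi_morphism.
have [j le_j ->] := exec_subst opB hom msp
  (fun y => phi_prog (zip a' o') y (@Return L OA OB n)) betaM leavesT.
rewrite evalT exec_phi /= -iterD iter_step0 /=; split.
  rewrite !(morphism_phi _ _ _ alpha'M, morphism_phi _ _ _ alphaM) eq_p0.
  (* What remains is that alpha' and [alpha] agree on each b_i, which lies in S_B. *)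
  congr (phi opB _ oB _); apply: eq_from_tnth => i; rewrite !tnth_map.
  apply: (eq_morphism_generated alpha'M alphaM) (hb i) => i'.
  by rewrite eq_t tnth_map.
have size_gt0: 0 < tree_size (msp a0') by case: (msp a0').
(* The first reply, of size [k.*2.+1], pays for the [k] evaluations of alpha'. *)
by apply: efficient_two_queries => //; nia.
Qed.
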